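(* Let $E$ be a Banach space such that $(B_{E^{\ast}}, \omega^{\ast})$ is convex block compact. Let $A$ and $B$ be bounded, closed and convex subsets of $E$ with distance $d(A,B) > 0$. If every $x^{\ast} \in E^{\ast}$ with \[ \sup_{b \in B} x^{\ast}(b) < \inf_{a \in A} x^{\ast}(a) \] attains its infimum on $A$ and its supremum on $B$, then $A$ and $B$ are both weakly compact.
   Context: Banach spaces are real. $B_{E^\ast}$ is the closed unit ball of the dual $E^\ast$, and $\omega^\ast$ is the weak$^\ast$ topology $\sigma(E^\ast,E)$. $d(A,B) := \inf\{\|a-b\| : a \in A, b \in B\}$. Given a sequence $(x_n)_{n\in\mathbb{N}}$ in a vector space, a sequence $(y_n)_{n\in\mathbb{N}}$ is a convex block subsequence of $(x_n)$ if there exist a sequence $(A_n)_{n\in\mathbb{N}}$ of pairwise disjoint finite subsets of $\mathbb{N}$ and a sequence $(\lambda_k)_{k\in\mathbb{N}}$ of real numbers $\lambda_k \ge 0$ such that $y_n = \sum_{k\in A_n}\lambda_k x_k$ and $\sum_{k\in A_n}\lambda_k = 1$ for each $n$. A subset $C$ of a topological vector space $(X,\tau)$ is convex block compact if every sequence of elements of $C$ admits a convex block subsequence which $\tau$-converges to an element of $C$. *)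

(* Defs.v *)
From HB Require Import structures.
From mathcomp Require Import all_boot all_order all_algebra finmap.
From mathcomp Require Import all_classical all_reals all_analysis.

Set Implicit Arguments.
Unset Strict Implicit.
Unset Printing Implicit Defensive.

Import Order.TTheory GRing.Theory Num.Theory.
Import numFieldNormedType.Exports.

Local Open Scope classical_set_scope.
Local Open Scope ring_scope.

Section Dual.
Context {R : realType} (E : normedModType R).

Definition dual_pred : {pred E -> R^o} :=
  mem [set f : E -> R^o | linear f /\ continuous f].

Lemma dual_pred_submod_closed : submod_closed dual_pred.
Proof.
split=> [|a f g].
  rewrite inE; split; last exact: cst_continuous.
  by move=> a x y; rewrite /= scaler0 addr0.
rewrite !inE => -[fl fc] [gl gc]; split.
  move=> k x y; rewrite !fctE fl gl !scalerDr !scalerA mulrC -!addrA.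
  by congr (_ + _); rewrite addrCA.
by move=> x; apply: cvgD; [apply: cvgZl_tmp; exact: fc|exact: gc].
Qed.

HB.instance Definition _ :=
  GRing.isSubmodClosed.Build R (E -> R^o) dual_pred dual_pred_submod_closed.

(* E^*, as a subspace of E -> R *)
Record dual := Dual {
  dual_fun :> E -> R^o ;
  dual_funP : dual_fun \in dual_pred }.

HB.instance Definition _ := [isSub for dual_fun].
HB.instance Definition _ := [Choice of dual by <:].
HB.instance Definition _ := [SubChoice_isSubLmodule of dual by <:].

(* The topology put on E^* is sigma(E^*, E), induced by that of R^E; the norm
   topology of E^* plays no role, only [dual_norm] does. *)
HB.instance Definition _ := Topological.copy dual
  (initial_topology (fun f : dual => (f : E -> R^o) : {ptws E -> R^o})).

Definition dual_norm (f : dual) : R :=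
  sup [set `|f x| | x in [set x : E | `|x| <= 1]].

Definition dual_unit_ball : set dual := [set f | dual_norm f <= 1].

(* E with its weak topology, the initial one for the elements of E^* *)
Definition weak_space :=
  initial_topology
    (fun x : E => (fun f : dual => f x) : {ptws dual -> R^o}).

HB.instance Definition _ := Topological.on weak_space.

Definition weakly_compact (A : set E) : Prop := @compact weak_space A.

End Dual.

Arguments dual_unit_ball {R} E _.

Definition convex_block_subsequence {R : realType} {X : lmodType R}
    (x y : nat -> X) : Prop :=
  exists (A : nat -> {fset nat}) (coef : nat -> R),
    [/\ forall m n, m != n -> [disjoint A m & A n]%fset,
        forall k, 0 <= coef k,
        forall n, y n = \sum_(k <- A n) coef k *: x k &
        forall n, \sum_(k <- A n) coef k = 1].

Definition convex_block_compact {R : realType} {X : preTopologicalLmodType R}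
    (C : set X) : Prop :=
  forall x : nat -> X, (forall n, C (x n)) ->
    exists y : nat -> X, convex_block_subsequence x y /\
      exists2 l, C l & y @ \oo --> l.

Section Extrema.
Context {R : realType} {E : normedModType R}.
Local Open Scope ereal_scope.

(* Extrema are taken in \bar R, so that the infimum over the empty set is
   +oo and the supremum over it is -oo. *)
Definition set_dist (A B : set E) : \bar R :=
  ereal_inf [set `|a - b|%R%:E | a in A & b in B].

Definition inf_on (A : set E) (f : dual E) : \bar R :=
  ereal_inf [set (f a)%:E | a in A].

Definition sup_on (A : set E) (f : dual E) : \bar R :=
  ereal_sup [set (f a)%:E | a in A].

Definition attains_inf (A : set E) (f : dual E) : Prop :=
  exists2 a, A a & (f a)%:E = inf_on A f.

Definition attains_sup (A : set E) (f : dual E) : Prop :=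
  exists2 a, A a & (f a)%:E = sup_on A f.

End Extrema.

(* Main.v *)
Require Import Defs.
From HB Require Import structures.
From mathcomp Require Import all_boot all_order all_algebra finmap.
From mathcomp Require Import all_classical all_reals all_analysis.
From mathcomp Require Import ring lra.
Import Order.TTheory GRing.Theory Num.Theory.
Import numFieldNormedType.Exports.
Local Open Scope classical_set_scope.
Local Open Scope ring_scope.

Set Implicit Arguments.
Unset Strict Implicit.
Unset Printing Implicit Defensive.

(** Why the theorem holds.  Let [C] be the set of differences [a - b].  It is
convex, bounded and at positive distance from [0], and the hypothesis says that
every functional which is at least [1] on [C] attains its minimum on [C].  A
point of the weak-star closure of [A] in the bidual differs by an element of [E]
from a point of the weak-star closure of [C], and likewise for [B] up to sign,
so it suffices that the weak-star closure of [C] lies in [E].  The bidual itself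
is avoided: a point of that closure is a function [phi] on the dual that is
[approximated] on finite sets of functionals by points of [C].

Suppose that such a [phi] is not an evaluation.  Shrinking [phi] towards [0]
until it is about to leave the closure of [C] gives [psi = phi / m], which is
still in the closure and not in [E], and is now visible from [0]: for each
[d > 0] some functional [h] is at least [1] on [C] with [psi h <= 1 + d]
([approximated_visible]).  This is where a hypothesis on positive functionals
alone becomes usable.

Because [E] is complete, [psi] has distance more than some [th > 0] from [E]
([functional_far]); as in James' theorem this yields [f k] in the dual ball and
[x j] in [C] with [f k (x j)] about [th] for [k <= j] and about [0] for [j < k],
where moreover [h (x j)] is close to [1] ([james_sequence]).  Convex block
compactness turns the [f k] into functionals [F n] that converge to [0] pointwise
while [F n (x j)] stays close to [th] for [j] large
([weak_star_null_blocks]).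

Now fix [M] larger than the values on [C] of all functionals in play.  For every
infinite convex combination [g] of the [F n], the functional [M h - g] is at
least [1] on [C], so [g - M h] attains its maximum on [C], and looking at [x j]
this maximum exceeds [- M] by a fixed fraction of [th].  Simons' inequality
([simons_inequality]) then provides one point [c] of [C] at which the upper limit
of the [F n c - M h c] exceeds [- M]; but [F n c] tends to [0] and [h c >= 1].
Here [M] is chosen before [d], and [M d] is small compared with [th]; this is
why approximate visibility suffices.

The separation arguments rest on two tools: the Hahn-Banach theorem
([sublinear_dominates_linear]) for the norm of [E], and a least-distance argument
in finite dimension ([approximate_or_separate]) for weak-star approximation. *)

(** * The Hahn-Banach theorem *)

Definition convex_in {R : realType} {V : lmodType R} (C : set V) : Prop :=
  forall x y t, C x -> C y -> 0 <= t -> t <= 1 -> C (t *: x + (1 - t) *: y).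

Lemma convex_set_in (R : realType) (V : lmodType R) (C : set V) :
  convex_set C -> convex_in C.
Proof.
move=> /convex_setW cC x y t Cx Cy t0 t1.
have [->|tn0] := eqVneq t 0; first by rewrite scale0r add0r subr0 scale1r.
have [->|tn1] := eqVneq t 1; first by rewrite scale1r subrr scale0r addr0.
have t0' : 0 < t by rewrite lt_neqAle eq_sym tn0.
have t1' : t < 1 by rewrite lt_neqAle tn1.
have tI : Itv.spec (@Itv.num_sem R) (Itv.Real `[0%Z, 1%Z]) t.
  by apply/and3P; split; rewrite ?num_real// ?bnd_simp.
have := cC x y; rewrite !inE => /(_ Cx Cy (Itv.mk tI) t0' t1').
by rewrite inE.
Qed.

Section HahnBanach.
Context {R : realType} {V : lmodType R}.
Implicit Types (p q : V -> R) (C : set V).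

Definition sublinear p : Prop :=
  (forall x y, p (x + y) <= p x + p y) /\
  (forall t x, 0 <= t -> p (t *: x) = t * p x).

Lemma sublinear0 p : sublinear p -> p 0 = 0.
Proof. by move=> [_ pZ]; rewrite -(scale0r 0) pZ// mul0r. Qed.

Lemma sublinear_geN p x : sublinear p -> - p (- x) <= p x.
Proof.
move=> sp; have := sp.1 x (- x); rewrite subrr sublinear0// => ?.
by rewrite lerNl -subr_ge0 opprK addrC.
Qed.

Lemma sublinearW p : (forall x y, p (x + y) <= p x + p y) -> p 0 = 0 ->
  (forall t x, 0 < t -> p (t *: x) <= t * p x) -> sublinear p.
Proof.
move=> pD p0 pZ; split=> // t x; rewrite le_eqVlt => /orP[/eqP<-|t0].
  by rewrite scale0r mul0r.
apply/eqP; rewrite eq_le pZ//=.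
have := pZ t^-1 (t *: x); rewrite scalerA mulVf ?gt_eqF// scale1r invr_gt0 t0.
by move=> /(_ isT); rewrite ler_pdivlMl.
Qed.

(** The infimum of [p (y + t c) - t r] over [t >= 0] and [c] in [C] works: it is
subadditive because [C] is convex, it is finite because [r <= p] on [C], and
[t = 1] gives its value at [- c].  With [C] a singleton this is the step in
Hahn-Banach that makes a minimal sublinear functional odd; with [C] convex it is
the separation of [C] from a ball. *)
Lemma sublinear_lower_along p C (r : R) : sublinear p -> C !=set0 ->
  convex_in C -> (forall c, C c -> r <= p c) ->
  exists q, [/\ sublinear q, forall y, q y <= p y &
    forall c, C c -> q (- c) <= - r].
Proof.
move=> sp [c0 Cc0] cC Cr.
pose S y := [set s | exists t c, [/\ 0 <= t, C c & s = p (y + t *: c) - t * r]].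
have Sp y : S y (p y).
  by exists 0, c0; rewrite scale0r addr0 mul0r subr0; split.
have Slb y : lbound (S y) (- p (- y)).
  move=> _ [t [c [t0 Cc ->]]].
  have h1 := sp.1 (y + t *: c) (- y).
  rewrite addrAC subrr add0r sp.2// in h1.
  have h2 : t * r <= t * p c by rewrite ler_wpM2l// Cr.
  lra.
have Sinf y : has_inf (S y) by split; [exists (p y)|exists (- p (- y))].
have inf_le y s : S y s -> inf (S y) <= s.
  by move=> Ss; apply: ge_inf => //; exact: (Sinf y).2.
exists (fun y => inf (S y)); split; last 2 first.
- by move=> y; exact: inf_le.
- move=> c Cc; apply: inf_le; exists 1, c; split=> //.
  by rewrite scale1r addNr sublinear0// mul1r sub0r.
apply: sublinearW.
- move=> x y; apply/ler_addgt0Pr => e e0; have e20 : 0 < e / 2 by lra.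
  have [_ [t [c [t0 Cc ->]]] h1] := inf_adherent e20 (Sinf x).
  have [_ [u [d [u0 Cd ->]]] h2] := inf_adherent e20 (Sinf y).
  suff : inf (S (x + y)) <= (p (x + t *: c) - t * r) + (p (y + u *: d) - u * r).
    by lra.
  have [tu0|tu0] := eqVneq (t + u) 0.
    have -> : t = 0 by lra.
    have -> : u = 0 by lra.
    rewrite !scale0r !addr0 !mul0r !subr0; apply: le_trans (sp.1 x y).
    exact: inf_le.
  have tup : 0 < t + u by lra.
  pose z := (t / (t + u)) *: c + (1 - t / (t + u)) *: d.
  have Cz : C z.
    apply: cC => //; first by rewrite divr_ge0// ltW.
    by rewrite ler_pdivrMr// mul1r; lra.
  have ez : (t + u) *: z = t *: c + u *: d.
    rewrite /z scalerDr !scalerA; congr (_ *: _ + _ *: _); field => //.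
  apply: (@le_trans _ _ (p (x + y + (t + u) *: z) - (t + u) * r)).
    by apply: inf_le; exists (t + u), z; split => //; lra.
  rewrite ez (_ : x + y + _ = (x + t *: c) + (y + u *: d)).
    by have := sp.1 (x + t *: c) (y + u *: d); lra.
  by rewrite addrACA.
- apply/eqP; rewrite eq_le (le_trans (inf_le _ _ (Sp _))) ?sublinear0//=.
  apply: lb_le_inf; first by exists (p 0).
  by have := Slb 0; rewrite oppr0 sublinear0// oppr0.
- move=> t x t0; rewrite -ler_pdivrMl//.
  apply: lb_le_inf; first by exists (p x).
  move=> _ [u [c [u0 Cc ->]]]; rewrite ler_pdivrMl//.
  apply: inf_le; exists (t * u), c; split => //; first by rewrite mulr_ge0// (ltW t0).
  by rewrite -scalerA -scalerDr sp.2 ?(ltW t0)//; ring.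
Qed.

(** Zorn's lemma gives a minimal sublinear functional below [p].  It is odd,
since otherwise [sublinear_lower_along] would lower it at [- y], and an odd
sublinear functional is linear. *)
Theorem sublinear_dominates_linear p : sublinear p ->
  exists f : V -> R^o, linear f /\ forall x, f x <= p x.
Proof.
move=> sp.
pose T := {q : V -> R | sublinear q /\ forall x, q x <= p x}.
pose le (q s : T) := `[< forall x, sval s x <= sval q x >].
have [||||q qmin] := @Zorn T le.
- by move=> q; apply/asboolP.
- move=> q s u /asboolP qs /asboolP su; apply/asboolP => x.
  exact: le_trans (su x) (qs x).
- move=> [q hq] [s hs] /asboolP/= qs /asboolP/= sq.
  have e : q = s by apply/funext => x; apply/eqP; rewrite eq_le sq qs.
  by case: _ / e hs {qs sq} => hs; congr exist; exact: Prop_irrelevance.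
- move=> A totA; have [->|/set0P[s0 As0]] := eqVneq A set0.
    by exists (exist _ p (conj sp (fun x => lexx (p x)))).
  pose S x := [set sval s x | s in A].
  have Slb x : lbound (S x) (- p (- x)).
    move=> _ [s As <-]; have [ss sp'] := svalP s.
    by apply: le_trans _ (sublinear_geN x ss); rewrite lerN2.
  have Sinf x : has_inf (S x).
    by split; [exists (sval s0 x), s0|exists (- p (- x))].
  have inf_le x s : A s -> inf (S x) <= sval s x.
    by move=> As; apply: ge_inf; [exact: (Sinf x).2|exists s].
  have sinf : sublinear (fun x => inf (S x)).
    apply: sublinearW.
    + move=> x y; apply/ler_addgt0Pr => e e0; have e20 : 0 < e / 2 by lra.
      have [_ [s As <-] h1] := inf_adherent e20 (Sinf x).
      have [_ [u Au <-] h2] := inf_adherent e20 (Sinf y).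
      have [w Aw [ws wu]] : exists2 w, A w &
          (forall x, sval w x <= sval s x) /\ (forall x, sval w x <= sval u x).
        have [/asboolP su|/asboolP us] := totA s u As Au.
          by exists u.
        by exists s.
      have h3 := inf_le (x + y) _ Aw; have h4 := (svalP w).1.1 x y.
      have h5 := ws x; have h6 := wu y; lra.
    + apply/eqP; rewrite eq_le (le_trans (inf_le _ _ As0))/=; last first.
        by rewrite sublinear0//; exact: (svalP s0).1.
      apply: lb_le_inf; first by exists (sval s0 0), s0.
      by have := Slb 0; rewrite oppr0 sublinear0// oppr0.
    + move=> t x t0; rewrite -ler_pdivrMl//.
      apply: lb_le_inf; first by exists (sval s0 x), s0.
      move=> _ [s As <-]; rewrite ler_pdivrMl// -(svalP s).1.2 ?(ltW t0)//.
      exact: inf_le.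
  have infp x : inf (S x) <= p x.
    exact: le_trans (inf_le x _ As0) ((svalP s0).2 x).
  exists (exist _ (fun x => inf (S x)) (conj sinf infp)) => s As.
  by apply/asboolP => x /=; exact: inf_le.
have [sq qp] := svalP q.
have qN y : sval q (- y) = - sval q y.
  have [|||s [ss sq' sy]] :=
    @sublinear_lower_along (sval q) [set y] (sval q y) sq; first by exists y.
  - move=> _ _ t -> -> _ _; by rewrite -scalerDl addrC subrK scale1r.
  - by move=> _ ->.
  have sp' x : s x <= p x by exact: le_trans (sq' x) (qp x).
  have := qmin (exist _ s (conj ss sp')).
  have /[swap]/[apply] : le q (exist _ s (conj ss sp')) by apply/asboolP.
  move=> <-/=; apply/eqP; rewrite eq_le; apply/andP; split.
    apply: le_trans (sy y erefl) _; rewrite lerN2; exact: sq'.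
  by have := sublinear_geN (- y) ss; rewrite opprK.
exists (sval q); split => // a x y.
have qD u v : sval q (u + v) = sval q u + sval q v.
  apply/eqP; rewrite eq_le sq.1/=.
  by have := sq.1 (- u) (- v); rewrite -opprD !qN -opprD lerN2.
rewrite qD; congr (_ + _); have [a0|a0] := leP 0 a; first exact: sq.2.
rewrite -[a]opprK scaleNr qN sq.2 ?oppr_ge0 ?(ltW a0)//.
by rewrite /GRing.scale/=; ring.
Qed.

End HahnBanach.

(** * Separation in finite dimension, and Simons' inequality *)

Section RealLemmas.
Context {R : realType}.

(** The image of [W] under [u] is a bounded convex subset of R^n: either [0] is
in its closure or a hyperplane separates it from [0].  The normal [a] is a point
of the image almost nearest to [0].  Convexity is asked of the image alone, so
that [W] can be a set in [E] as well as the unit ball of the dual. *)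
Lemma approximate_or_separate (T : Type) (W : set T) n (u : 'I_n -> T -> R)
    (K : R) : W !=set0 ->
  (forall w w' t, W w -> W w' -> 0 <= t -> t <= 1 ->
     exists2 z, W z & forall i, u i z = t * u i w + (1 - t) * u i w') ->
  (forall i w, W w -> `|u i w| <= K) ->
  (forall e, 0 < e -> exists2 w, W w & forall i, `|u i w| < e) \/
  (exists a : 'I_n -> R, exists2 e, 0 < e &
     forall w, W w -> e <= \sum_i a i * u i w).
Proof.
move=> [w1 Ww1] Wconv Wbnd.
pose q w := \sum_i u i w ^+ 2.
have q0 w : 0 <= q w by apply: sumr_ge0 => i _; exact: sqr_ge0.
pose S := [set q w | w in W].
have Sinf : has_inf S.
  by split; [exists (q w1), w1|exists 0 => _ [w _ <-]].
set d := inf S.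
have d_le w : W w -> d <= q w by move=> Ww; apply: ge_inf Sinf.2 _ _; exists w.
have [dn|dp] := leP d 0.
  left => e e0; have e20 : 0 < e ^+ 2 by rewrite exprn_gt0.
  have [_ [w Ww <-] qw] := inf_adherent e20 Sinf.
  exists w => // i.
  rewrite -(ltr_pXn2r (n := 2))// ?nnegrE ?(ltW e0)// real_normK ?num_real//.
  apply: (@le_lt_trans _ _ (q w)).
    rewrite /q (bigD1 i)//= lerDl; apply: sumr_ge0 => j _; exact: sqr_ge0.
  by rewrite -/d in qw; lra.
right.
pose Q := n%:R * (2 * K) ^+ 2.
have Q0 : 0 <= Q by rewrite mulr_ge0// sqr_ge0.
have XQ w w' : W w -> W w' -> \sum_i (u i w - u i w') ^+ 2 <= Q.
  move=> Ww Ww'; rewrite /Q -[n in n%:R]card_ord mulr_natl -sumr_const.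
  apply: ler_sum => i _; rewrite -real_normK ?num_real//.
  rewrite ler_pXn2r ?nnegrE//.
    apply: le_trans (ler_normB _ _) _.
    by have := Wbnd i w Ww; have := Wbnd i w' Ww'; lra.
  by have := Wbnd i w Ww; have := normr_ge0 (u i w); lra.
(* If w0 is almost nearest to 0, then moving by t from w0 towards w cannot lower
   q by more than t d / 2; the second-order term t ^ 2 Q is absorbed since
   t Q <= d / 2. *)
pose t := d / (2 * (Q + 1) + d).
have t0 : 0 < t by rewrite divr_gt0//; lra.
have t1 : t <= 1 by rewrite ler_pdivrMr; lra.
have tQ : t * Q <= d / 2.
  rewrite /t mulrAC ler_pdivrMr; last by lra.
  have : 0 <= d * d by rewrite mulr_ge0// ltW.
  nra.
have eta0 : 0 < t * d / 2 by rewrite divr_gt0// mulr_gt0.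
have [_ [w0 Ww0 <-] qw0] := inf_adherent eta0 Sinf; rewrite -/d in qw0.
exists (fun i => u i w0), (d / 2); first by lra.
move=> w Ww; have [z Wz uz] := Wconv w w0 t Ww Ww0 (ltW t0) t1.
have := d_le z Wz.
have -> : q z = q w0 + 2 * t * (\sum_i u i w0 * u i w - q w0) +
    t ^+ 2 * \sum_i (u i w - u i w0) ^+ 2.
  rewrite /q -sumrB !mulr_sumr -!big_split/=; apply: eq_bigr => i _.
  by rewrite uz; ring.
move=> dz; have X := XQ _ _ Ww Ww0; have dw0 := d_le _ Ww0.
set P := \sum_i u i w0 * u i w in dz *.
set Y := \sum_i _ in dz X.
have h1 : t ^+ 2 * Y <= t * (d / 2).
  rewrite expr2 -mulrA ler_pM2l//; apply: le_trans tQ.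
  by rewrite ler_pM2l.
have h2 : 0 <= t * (2 * (P - q w0) + d) by lra.
by move: h2; rewrite pmulr_rge0//; lra.
Qed.

(** The partial sums of an infinite convex combination with weights 2^-(p+1). *)
Definition dyadic (a : nat -> R) : nat -> R :=
  series (fun p => 2^-1 ^+ p.+1 * a p).

Lemma dyadicS a n : dyadic a n.+1 = dyadic a n + 2^-1 ^+ n.+1 * a n.
Proof. by rewrite /dyadic /series/= big_nat_recr. Qed.

Lemma dyadic0 a : dyadic a 0 = 0.
Proof. by rewrite /dyadic /series/= big_geq. Qed.

(** The tail is again such a combination, with total weight 2^-n. *)
Lemma dyadic_shift a n k :
  dyadic a (k + n) = dyadic a n + 2^-1 ^+ n * dyadic (fun p => a (p + n)%N) k.
Proof.
elim: k => [|k IH]; first by rewrite dyadic0 mulr0 addr0.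
by rewrite addSn !dyadicS IH -addSn exprD; ring.
Qed.

Lemma dyadic_ge a n (b : R) : (forall p, (p < n)%N -> b <= a p) ->
  (1 - 2^-1 ^+ n) * b <= dyadic a n.
Proof.
elim: n => [|n IH] ab; first by rewrite dyadic0 expr0 subrr mul0r.
have h1 := IH (fun p pn => ab p (ltnW pn)).
have h2 := ab n (ltnSn n).
have h3 : 0 < 2^-1 ^+ n :> R by rewrite exprn_gt0.
by rewrite dyadicS exprS; nra.
Qed.

Lemma dyadicD a b (k : R) n :
  dyadic (fun p => k * a p + b p) n = k * dyadic a n + dyadic b n.
Proof.
elim: n => [|n IH]; first by rewrite !dyadic0 mulr0 addr0.
by rewrite !dyadicS IH; ring.
Qed.

Lemma cvg_half : (fun n => 2^-1 ^+ n : R) @ \oo --> (0 : R).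
Proof. by apply: cvg_expr; rewrite gtr0_norm//; lra. Qed.

Lemma dyadic_cst (b : R) : dyadic (fun=> b) @ \oo --> b.
Proof.
rewrite (_ : dyadic _ = fun n => (1 - 2^-1 ^+ n) * b).
  rewrite -[X in _ --> X]mul1r -[X in X * b]subr0.
  by apply: cvgMl; apply: cvgB; [exact: cvg_cst|exact: cvg_half].
apply/funext; elim=> [|n IH]; first by rewrite dyadic0 expr0 subrr mul0r.
by rewrite dyadicS IH exprS; field.
Qed.

Lemma dyadic_bounded_cvg a (K : R) : (forall p, `|a p| <= K) -> cvgn (dyadic a).
Proof.
move=> aK; apply: normed_cvg.
apply: (@series_le_cvg _ _ (fun p => 2^-1 ^+ p.+1 * K)) => [p|p|p|].
- exact: normr_ge0.
- by rewrite mulr_ge0 ?exprn_ge0//; exact: le_trans (aK p).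
- by rewrite /= normrM gtr0_norm ?exprn_gt0// ler_pM2l ?exprn_gt0.
- by apply/cvg_ex; exists K; exact: dyadic_cst.
Qed.

Lemma dyadic_lim_ge a (b l : R) : dyadic a @ \oo --> l -> (forall p, b <= a p) ->
  b <= l.
Proof.
move=> al ab; apply: (@ler_cvg_to _ _ _ R _ _ _ _ (@dyadic_cst b) al); apply: nearW.
elim=> [|n IH]; first by rewrite !dyadic0.
by rewrite !dyadicS lerD// ler_pM2l ?exprn_gt0.
Qed.

Lemma dyadic_lim_le a (b l : R) : dyadic a @ \oo --> l -> (forall p, a p <= b) ->
  l <= b.
Proof.
move=> al ab; apply: (@ler_cvg_to _ _ _ R _ _ _ _ al (@dyadic_cst b)); apply: nearW.
elim=> [|n IH]; first by rewrite !dyadic0.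
by rewrite !dyadicS lerD// ler_pM2l ?exprn_gt0.
Qed.

(** Simons' inequality.  [D n] stands for the infinite convex combinations of a
sequence from its [n]-th term on.  The terms [g n] are picked greedily: with [v n] the partial dyadic sum,
[g n] nearly minimizes over [D n] the supremum on [C] of [v n + 2^-n g].  The full
sum [u] is such a candidate at each stage, so [v n + 2^-n (g n)] exceeds by
little the value of [u] at its maximum point [c].  As [v n.+1] is the mean of [v n]
and [v n + 2^-n (g n)], this bounds [v n c] above by about [(1 - 2^-n) u c], so the
tail [t], an element of [D n], satisfies [t c >= u c - eps]. *)
Lemma simons_inequality (T : Type) (C : set T) (D : nat -> set (T -> R))
    (rho m eps : R) : 0 < eps ->
  (forall n, D n !=set0) -> (forall n, D n.+1 `<=` D n) ->
  (forall g x, D 0%N g -> C x -> `|g x| <= rho) ->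
  (forall n (g : nat -> T -> R), (forall p, D n (g p)) ->
     exists2 u, D n u &
       forall x, C x -> dyadic (fun p => g p x) @ \oo --> u x) ->
  (forall g, D 0%N g ->
     exists2 c, C c & m <= g c /\ forall x, C x -> g x <= g c) ->
  exists2 c, C c & forall n, exists2 g, D n g & m - eps <= g c.
Proof.
move=> eps0 Dn0 DS Dbnd Dser Dmax.
have Dle n k : (n <= k)%N -> D k `<=` D n.
  move=> /subnK <-; elim: (k - n)%N => [|j IH]//= g.
  by rewrite addSn => /DS /IH.
have [g0 /Dmax[x0 Cx0 _]] := Dn0 0%N.
have step_ex (nv : nat * (T -> R)) : exists g, D nv.1 g /\
    forall h (b : R), D nv.1 h ->
    (forall x, C x -> nv.2 x + 2^-1 ^+ nv.1 * h x <= b) ->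
    forall x, C x ->
      nv.2 x + 2^-1 ^+ nv.1 * g x <= b + eps / 2 * 2^-1 ^+ nv.1 * 2^-1 ^+ nv.1.
  case: nv => n v /=.
  have hn0 : 0 < 2^-1 ^+ n :> R by rewrite exprn_gt0.
  pose S := [set b | exists2 h, D n h &
     forall x, C x -> v x + 2^-1 ^+ n * h x <= b].
  (* without any upper bound to improve on, every element of D n will do *)
  have [S0|/set0P Sn0] := eqVneq S set0.
    have [g Dg] := Dn0 n; exists g; split=> // h b Dh hb.
    by have : S b by [exists h]; rewrite S0.
  have Sinf : has_inf S.
    split=> //; exists (v x0 - 2^-1 ^+ n * rho) => b [h Dh hb].
    apply: le_trans (hb x0 Cx0).
    rewrite lerD2l -mulrN ler_pM2l//.
    have := Dbnd h x0 (Dle 0%N n (leq0n n) _ Dh) Cx0.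
    by rewrite ler_norml => /andP[].
  have e0 : 0 < eps / 2 * 2^-1 ^+ n * 2^-1 ^+ n by rewrite !mulr_gt0//; lra.
  have [b [g Dg gb] bS] := inf_adherent e0 Sinf.
  exists g; split=> // h b' Dh hb' x Cx; apply: le_trans (gb x Cx) _.
  by apply/ltW/(lt_le_trans bS); rewrite lerD2r; apply: ge_inf Sinf.2 _ _; exists h.
have [pick pickP] := choice step_ex.
pose v := fix v n : T -> R := if n is k.+1 then
  (fun x => v k x + 2^-1 ^+ k.+1 * pick (k, v k) x) else (fun=> 0).
pose g n := pick (n, v n).
have Dg n : D n (g n) by exact: (pickP (n, v n)).1.
have gmin n h (b : R) : D n h -> (forall x, C x -> v n x + 2^-1 ^+ n * h x <= b) ->
    forall x, C x ->
    v n x + 2^-1 ^+ n * g n x <= b + eps / 2 * 2^-1 ^+ n * 2^-1 ^+ n.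
  exact: (pickP (n, v n)).2.
have vE n x : v n x = dyadic (fun p => g p x) n.
  by elim: n => [|n IH]; rewrite ?dyadic0// dyadicS /= IH.
have [u Du u_lim] := Dser 0%N g (fun p => Dle _ _ (leq0n p) _ (Dg p)).
have tail n : exists2 t, D n t & forall x, C x -> u x = v n x + 2^-1 ^+ n * t x.
  have [t Dt t_lim] := Dser n (fun p => g (p + n)%N)
    (fun p => Dle _ _ (leq_addl p n) _ (Dg _)).
  exists t => // x Cx.
  have := u_lim x Cx; rewrite -(cvg_shiftn n) => lim1.
  suff lim2 : (fun k => dyadic (fun p => g p x) (k + n)%N) @ \oo -->
      v n x + 2^-1 ^+ n * t x.
    exact: (cvg_unique (@Rhausdorff R) lim1 lim2).
  under eq_fun do rewrite dyadic_shift.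
  by rewrite vE; apply: cvgD; [exact: cvg_cst|apply: cvgMr; exact: t_lim].
have [c Cc [mc cmax]] := Dmax u Du.
exists c => // n.
have key k : v k c <= (1 - 2^-1 ^+ k) * u c +
    eps * 2^-1 ^+ k * (1 - 2^-1 ^+ k).
  elim: k => [|k IH]; first by rewrite /= expr0 subrr mul0r mulr0 addr0.
  have [t Dt tE] := tail k.
  have h x : C x -> v k x + 2^-1 ^+ k * t x <= u c.
    by move=> Cx; rewrite -tE//; exact: cmax.
  have gc := gmin k t (u c) Dt h c Cc.
  rewrite /= -/(g k) exprS.
  set z := 2^-1 ^+ k in IH gc *.
  lra.
have [t Dt tE] := tail n.
exists t => //.
have zp : 0 < 2^-1 ^+ n :> R by rewrite exprn_gt0.
have := key n; have := tE c Cc.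
set z := 2^-1 ^+ n in zp *.
move=> h1 h2.
have h3 : 0 <= z * (t c - u c + eps * (1 - z)) by lra.
have : 0 <= t c - u c + eps * (1 - z) by rewrite -(pmulr_rge0 _ zp).
have : 0 <= eps * z by rewrite mulr_ge0 ?ltW.
lra.
Qed.
End RealLemmas.

(** * The dual space and its weak-star topology *)

Section DualTheory.
Context {R : realType} {E : normedModType R}.
Implicit Types (f g : dual E) (x y : E) (C : set E).

Lemma dual_lin f (a : R) x y : f (a *: x + y) = a * (f x : R) + f y :> R.
Proof. by have := dual_funP f; rewrite inE => -[fl _]; rewrite fl. Qed.

Lemma dualD f x y : f (x + y) = (f x : R) + f y :> R.
Proof. by rewrite -[x in LHS]scale1r dual_lin mul1r. Qed.

Lemma dual0 f : f 0 = 0 :> R.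
Proof. by have := dualD f 0 0; rewrite addr0 => ?; lra. Qed.

Lemma dualZ f (a : R) x : f (a *: x) = a * (f x : R) :> R.
Proof. by rewrite -[a *: x]addr0 dual_lin dual0 addr0. Qed.

Lemma dualN f x : f (- x) = - (f x : R) :> R.
Proof. by rewrite -scaleN1r dualZ mulN1r. Qed.

Lemma dualB f x y : f (x - y) = (f x : R) - f y :> R.
Proof. by rewrite dualD dualN. Qed.

Lemma dual_sum f (I : Type) (s : seq I) (F : I -> E) :
  f (\sum_(i <- s) F i) = \sum_(i <- s) (f (F i) : R) :> R.
Proof. exact: (big_morph f (dualD f) (dual0 f)). Qed.

Lemma dual_addE f g x : (f + g) x = (f x : R) + g x :> R. Proof. by []. Qed.
Lemma dual_oppE f x : (- f) x = - (f x : R) :> R. Proof. by []. Qed.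
Lemma dual_scaleE (a : R) f x : (a *: f) x = a * (f x : R) :> R. Proof. by []. Qed.

Lemma dual_sumE (I : Type) (s : seq I) (F : I -> dual E) x :
  (\sum_(i <- s) F i) x = \sum_(i <- s) (F i x : R) :> R.
Proof. exact: (big_morph (fun f : dual E => f x)). Qed.

Lemma bounded_linear_dual (f : E -> R^o) (K : R) : linear f ->
  (forall x, `|f x| <= K * `|x|) -> exists g : dual E, forall x, g x = f x.
Proof.
move=> lf bf.
pose F : {linear E -> R^o} :=
  HB.pack f (@GRing.isLinear.Build R E R^o *:%R f lf).
have cF : continuous F.
  apply/linear_bounded_continuous/linear_boundedP; exists K.
  split=> [|M KM x]; first exact: num_real.
  by apply: le_trans (bf x) _; rewrite ler_wpM2r// ltW.
have fP : f \in @dual_pred R E by rewrite inE.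
by exists (Dual fP).
Qed.

Lemma dual_bounded f : exists2 K, 0 < K & forall x, `|f x| <= K * `|x|.
Proof.
have := dual_funP f; rewrite inE => -[lf cf].
pose F : {linear E -> R^o} :=
  HB.pack (f : E -> R^o) (@GRing.isLinear.Build R E R^o *:%R f lf).
have : bounded_near F (nbhs 0) by exact/linear_bounded_continuous.
by move=> /linear_boundedP/pinfty_ex_gt0[K K0 fK]; exists K.
Qed.

Lemma dual_unit_ballP f : dual_unit_ball E f <-> forall x, `|f x| <= `|x|.
Proof.
have [K K0 fK] := dual_bounded f.
have bS : has_ubound [set `|f x| | x in [set x : E | `|x| <= 1]].
  exists K => _ [x /= x1 <-]; apply: le_trans (fK x) _.
  by rewrite ler_piMr// ltW.
split=> [f1 x|f1]; last first.
  apply: ge_sup => [|_ [x /= x1 <-]]; last exact: le_trans (f1 x) x1.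
  by exists `|f 0|, 0 => //=; rewrite normr0.
have [->|x0] := eqVneq x 0; first by rewrite dual0 normr0 normr0.
have nx : 0 < `|x| by rewrite normr_gt0.
have : `|f (`|x|^-1 *: x)| <= 1.
  apply: le_trans f1; apply: ub_le_sup => //; exists (`|x|^-1 *: x) => //=.
  by rewrite normrZ gtr0_norm ?invr_gt0// mulVf ?gt_eqF.
by rewrite dualZ normrM gtr0_norm ?invr_gt0// ler_pdivrMl// mulr1.
Qed.

(** The norm lowered along [C] is a sublinear functional of value at most [- r]
on [- C]; a linear functional below it is bounded by the norm and at least [r]
on [C]. *)
Lemma dual_separation C (r : R) : C !=set0 -> convex_in C ->
  (forall c, C c -> r <= `|c|) ->
  exists f, (forall x, `|f x| <= `|x|) /\ forall c, C c -> r <= f c.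
Proof.
move=> C0 cC Cr.
have snorm : sublinear (fun x : E => `|x|).
  by split=> [|t x t0]; [exact: ler_normD|rewrite normrZ ger0_norm].
have [q [sq qn qC]] := sublinear_lower_along snorm C0 cC Cr.
have [f [lf fq]] := sublinear_dominates_linear sq.
have fD (a : R) x y : f (a *: x + y) = a * f x + f y by rewrite lf.
have f0 : f 0 = 0.
  by have := fD 1 0 0; rewrite mul1r scaler0 addr0 => ?; lra.
have fN x : f (- x) = - f x.
  by have := fD (-1) x 0; rewrite !addr0 scaleN1r f0 addr0 mulN1r.
have fn x : `|f x| <= 1 * `|x|.
  rewrite mul1r ler_norml; apply/andP; split.
    by rewrite lerNl -fN -normrN; exact: le_trans (fq _) (qn _).
  exact: le_trans (fq _) (qn _).
have [F FE] := bounded_linear_dual lf fn.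
exists F; split=> [x|c Cc]; first by rewrite FE -[leRHS]mul1r.
by rewrite FE -lerN2 -fN; exact: le_trans (fq _) (qC _ Cc).
Qed.

Lemma norming_functional x :
  exists f, (forall y, `|f y| <= `|y|) /\ `|x| <= f x.
Proof.
have [||c ->|f [f1 fx]] := @dual_separation [set x] `|x|; first by exists x.
- by move=> _ _ t -> -> _ _; rewrite -scalerDl addrC subrK scale1r.
- by [].
by exists f; split=> //; exact: fx.
Qed.

Lemma weak_star_cvg (y : nat -> dual E) (l : dual E) : y @ \oo --> l ->
  forall x, (y n x) @[n --> \oo] --> l x.
Proof.
move=> yl x.
have c1 : continuous (fun f : dual E => (f : E -> R^o) : {ptws E -> R^o}).
  exact: initial_continuous.
have c2 : continuous (fun h : {ptws E -> R^o} => h x).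
  exact: (@proj_continuous E (fun=> R^o) x).
have c3 := @continuous_comp (dual E) {ptws E -> R^o} R^o _ _ l (c1 l) (c2 _).
exact: (cvg_comp _ _ yl c3).
Qed.

End DualTheory.

(** * Points of the weak-star closure *)

Section WeakApproximation.
Context {R : realType} {E : normedModType R}.
Implicit Types (f g h : dual E) (x : E) (C : set E) (phi psi : dual E -> R).

(** [phi] is in the closure of [C] in the weak-star topology of the bidual,
where [phi] is a priori any function on the dual. *)
Definition approximated C phi : Prop :=
  forall (s : seq (dual E)) e, 0 < e ->
    exists2 c, C c & forall g, g \in s -> `|g c - phi g| < e.

Definition functional phi : Prop :=
  forall (a : R) f g, phi (a *: f + g) = a * phi f + phi g.

Lemma approximated_functional C phi : approximated C phi -> functional phi.
Proof.
move=> Cphi a f g; apply/eqP; rewrite -subr_eq0 -normr_le0.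
apply/ler_addgt0Pr => e e0; rewrite add0r.
pose d := e / (`|a| + 2).
have a2 : 0 < `|a| + 2 by have := normr_ge0 a; lra.
have d0 : 0 < d by rewrite divr_gt0.
have ed : e = d + (`|a| * d + d) by rewrite /d; field; rewrite gt_eqF.
have [c Cc cs] := Cphi [:: a *: f + g; f; g] d d0.
have h1 := cs (a *: f + g); have h2 := cs f; have h3 := cs g.
move: h1 h2 h3; rewrite !inE !eqxx !orbT /= => /(_ isT) h1 /(_ isT) h2 /(_ isT) h3.
rewrite (_ : _ - _ =
  - ((a *: f + g) c - phi (a *: f + g)) + (a * (f c - phi f) + (g c - phi g))); last first.
  by rewrite dual_addE dual_scaleE; ring.
apply: le_trans (ler_normD _ _) _; rewrite ed normrN lerD ?(ltW h1)//.
apply: le_trans (ler_normD _ _) _; rewrite lerD ?(ltW h3)// normrM.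
by rewrite ler_wpM2l// ltW.
Qed.

Lemma approximated_ge C phi f (r : R) : approximated C phi ->
  (forall c, C c -> r <= f c) -> r <= phi f.
Proof.
move=> Cphi fr; apply/ler_addgt0Pr => e e0.
have [c Cc /(_ f)] := Cphi [:: f] e e0; rewrite inE eqxx => /(_ isT).
by rewrite ltr_norml => /andP[_]; have := fr c Cc; lra.
Qed.

Lemma functional0 phi : functional phi -> phi 0 = 0.
Proof.
by move=> lphi; have := lphi 1 0 0; rewrite scaler0 addr0 => ?; lra.
Qed.

Lemma functionalZ phi (a : R) f : functional phi -> phi (a *: f) = a * phi f.
Proof.
by move=> lphi; have := lphi a f 0; rewrite !addr0 functional0// addr0.
Qed.

Lemma functional_sum phi (I : Type) (s : seq I) (a : I -> R) (F : I -> dual E) :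
  functional phi ->
  phi (\sum_(i <- s) a i *: F i) = \sum_(i <- s) a i * phi (F i).
Proof.
move=> lphi; elim: s => [|i s IH]; first by rewrite !big_nil functional0.
by rewrite !big_cons lphi IH.
Qed.

Lemma approximated_norm C phi f (K : R) : approximated C phi ->
  (forall c, C c -> `|f c| <= K) -> `|phi f| <= K.
Proof.
move=> Cphi fK; rewrite ler_norml; apply/andP; split.
  apply: approximated_ge Cphi _ => c /fK; by rewrite ler_norml => /andP[].
have : - K <= phi (-1 *: f).
  apply: approximated_ge Cphi _ => c /fK; rewrite ler_norml => /andP[_].
  by rewrite dual_scaleE mulN1r lerN2.
by rewrite (functionalZ _ _ (approximated_functional Cphi)) mulN1r lerN2.
Qed.

(** [m] is the infimum of [phi h] over the [h] that are at least [1] on [C], so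
the second property of [phi / m] is immediate.  If [phi / m] were not approximated,
some [f] would satisfy [f >= phi f / m + r] on [C] with [r > 0].  Adding a large
multiple [t h] of a functional [h >= 1] makes the lower bound positive;
normalizing and using the definition of [m] gives [phi h >= m + m r / t] for all
[h], with [t] independent of [h], against the definition of [m]. *)
Lemma approximated_visible C phi h0 (rho : R) :
  convex_in C -> (forall c, C c -> `|c| <= rho) -> approximated C phi ->
  (forall c, C c -> 1 <= h0 c) ->
  exists m : R, [/\ 0 < m, approximated C (fun f => phi f / m) &
    forall d : R, 0 < d -> exists2 h : dual E, (forall c, C c -> 1 <= h c) &
      phi h / m <= 1 + d].
Proof.
move=> cC Crho Cphi h01.
have lphi := approximated_functional Cphi.
pose P h := forall c, C c -> 1 <= h c.
pose S := [set phi h | h in P].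
have phi1 h : P h -> 1 <= phi h by move=> Ph; exact: approximated_ge Cphi Ph.
have Sinf : has_inf S.
  by split; [exists (phi h0), h0|exists 1 => _ [h Ph <-]; exact: phi1].
set m := inf S.
have m1 : 1 <= m.
  by apply: lb_le_inf Sinf.1 _ => _ [h Ph <-]; exact: phi1.
have m0 : 0 < m by lra.
exists m; split=> //; last first.
  move=> d d0; have md : 0 < m * d by rewrite mulr_gt0.
  have [_ [h Ph <-] hm] := inf_adherent md Sinf; exists h => //.
  by rewrite ler_pdivrMr// ; rewrite -/m in hm; lra.
move=> s e e0.
have [c0 Cc0 _] := Cphi [::] 1 ltr01.
pose u (i : 'I_(size s)) c := s`_i c - phi s`_i / m.
have ubnd (i : 'I_(size s)) c : C c ->
    `|u i c| <= \sum_(j < size s) (sval (cid2 (dual_bounded s`_j)) * rho +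
        `|phi s`_j / m|).
  move=> Cc; rewrite (bigD1 i)//=; apply: ler_wpDr.
    apply: sumr_ge0 => j _; rewrite addr_ge0//.
    by case: cid2 => /= K K0 _; rewrite mulr_ge0// ?(ltW K0)//;
      apply: le_trans (Crho _ Cc).
  apply: le_trans (ler_normB _ _) _; rewrite lerD2r.
  case: cid2 => /= K K0 sK; apply: le_trans (sK c) _.
  by rewrite ler_pM2l// Crho.
have [||near_|[a [r r0 sep]]] :=
    @approximate_or_separate R E C (size s) u _ _ _ ubnd.
- by exists c0.
- move=> w w' t Cw Cw' t0 t1; exists (t *: w + (1 - t) *: w'); first exact: cC.
  by move=> i; rewrite /u dualD !dualZ; ring.
- have [c Cc uc] := near_ e e0; exists c => // g gs.
  have gi : (index g s < size s)%N by rewrite index_mem.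
  by have := uc (Ordinal gi); rewrite /u/= nth_index.
exfalso.
pose f := \sum_(i < size s) a i *: s`_i.
have phif : phi f = \sum_(i < size s) a i * phi s`_i by exact: functional_sum.
have fC c : C c -> phi f / m + r <= f c.
  move=> Cc; have := sep c Cc; rewrite /f dual_sumE phif => h.
  rewrite -lerBrDl; apply: le_trans h _; rewrite mulr_suml -sumrB.
  by apply: ler_sum => i _; rewrite /u dual_scaleE mulrBr mulrA.
set k := phi f / m + r in fC.
pose t := `|k| + 1.
have t0 : 0 < t by rewrite /t; have := normr_ge0 k; lra.
have kt : 0 < k + t.
  by rewrite /t; have := ler_norm (- k); rewrite normrN; lra.
suff : m + m * r / t <= m.
  have : 0 < m * r / t by rewrite divr_gt0// mulr_gt0.
  by lra.
apply: lb_le_inf Sinf.1 _ => _ [h Ph <-].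
have : m <= phi ((k + t)^-1 *: (t *: h + f)).
  apply: ge_inf Sinf.2 _ _; exists ((k + t)^-1 *: (t *: h + f)) => // c Cc.
  rewrite dual_scaleE dual_addE dual_scaleE ler_pdivlMl// mulr1.
  by have := fC c Cc; have := Ph c Cc; nra.
rewrite functionalZ// lphi ler_pdivlMl// => h1.
have h2 : (k + t) * m = phi f + m * r + t * m.
  by rewrite /k; field; rewrite gt_eqF.
rewrite -lerBrDl ler_pdivrMr//; lra.
Qed.

(** An approximate form of Helly's theorem.  Otherwise the unit ball would be
separated from the point [(th, 0, ..., 0)] by a functional
[a0 psi f + f y]; evaluating at [f = 0] shows [a0 < 0], and then
[psi f - f (y / - a0) < th] on the ball. *)
Lemma functional_near_kernel psi (th K : R) : functional psi -> 0 < th ->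
  (forall f, (forall x, `|f x| <= `|x|) -> `|psi f| <= K) ->
  (forall x, exists2 f : dual E, (forall x, `|f x| <= `|x|) & th < psi f - f x) ->
  forall (s : seq E) e, 0 < e ->
    exists f : dual E, [/\ forall x, `|f x| <= `|x|, th - e < psi f &
      forall x, x \in s -> `|f x| < e].
Proof.
move=> lpsi th0 psiK far s e e0.
pose W := [set f : dual E | forall x, `|f x| <= `|x|].
have W0 : W (0 : dual E) by move=> x; rewrite normr0.
(* index 0 carries psi, the others the points of s *)
pose u (i : 'I_(size s).+1) f :=
  if unlift ord0 i is Some j then f s`_j else psi f - th.
have ubnd (i : 'I_(size s).+1) f : W f ->
    `|u i f| <= K + th + \sum_(j < size s) `|s`_j|.
  have K0 : 0 <= K by apply: le_trans (psiK _ W0).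
  move=> Wf; rewrite /u; case: unliftP => [j _|_].
    apply: le_trans (Wf _) _; rewrite (bigD1 j)//= addrCA lerDl.
    by rewrite !addr_ge0// ?(ltW th0)//; apply: sumr_ge0.
  apply: ler_wpDr; first exact: sumr_ge0.
  apply: le_trans (ler_normB _ _) _; rewrite (gtr0_norm th0) lerD2r.
  exact: psiK.
have [||near_|[a [r r0 sep]]] :=
    @approximate_or_separate R _ W _ u _ _ _ ubnd.
- by exists 0.
- move=> f g t Wf Wg t0 t1; exists (t *: f + (1 - t) *: g).
    move=> x; rewrite dual_addE !dual_scaleE.
    apply: le_trans (ler_normD _ _) _; rewrite !normrM (ger0_norm t0).
    rewrite (ger0_norm (x := 1 - t)) ?subr_ge0//.
    have := Wf x; have := Wg x; nra.
  move=> i; rewrite /u; case: unliftP => [j _|_].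
    by rewrite dual_addE !dual_scaleE.
  by rewrite lpsi functionalZ//; ring.
- have [f Wf uf] := near_ e e0; exists f; split=> //.
    have := uf ord0; rewrite /u unlift_none ltr_norml => /andP[]; lra.
  move=> x xs; have xi : (index x s < size s)%N by rewrite index_mem.
  by have := uf (lift ord0 (Ordinal xi)); rewrite /u liftK/= nth_index.
exfalso.
pose y := \sum_(j < size s) a (lift ord0 j) *: s`_j.
have {}sep f : W f -> r <= a ord0 * (psi f - th) + f y.
  move=> /sep; rewrite big_ord_recl /u unlift_none /y dual_sum.
  by under eq_bigr do rewrite liftK -dualZ.
have a0 : a ord0 < 0.
  have := sep _ W0; rewrite functional0// (_ : (0 : dual E) y = 0)// sub0r addr0 mulrN.
  by rewrite -mulNr => h; rewrite -oppr_gt0 -(pmulr_lgt0 _ th0); lra.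
have [f Wf] := far ((- a ord0)^-1 *: y).
rewrite dualZ => h.
have h1 := sep f Wf.
have b0 : 0 < - a ord0 by lra.
have : - a ord0 * th < - a ord0 * (psi f - (- a ord0)^-1 * f y).
  by rewrite ltr_pM2l.
by rewrite mulrBr mulrA divff ?gt_eqF// mul1r; lra.
Qed.

(** [f k] is chosen nearly to vanish at the earlier points and to have [psi]
about [th]; then [x k] is chosen in [C] to imitate [psi] on [h] and on the
functionals found up to then. *)
Lemma james_sequence C psi h (th K eps : R) : approximated C psi -> 0 < th ->
  (forall f, (forall x, `|f x| <= `|x|) -> `|psi f| <= K) ->
  (forall x, exists2 f : dual E, (forall x, `|f x| <= `|x|) & th < psi f - f x) ->
  0 < eps ->
  exists (f : nat -> dual E) (x : nat -> E),
    [/\ forall n y, `|f n y| <= `|y|,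
        forall n, C (x n) /\ h (x n) <= psi h + eps,
        forall k j, (k <= j)%N -> th - eps <= f k (x j) &
        forall k j, (j < k)%N -> `|f k (x j)| <= k.+1%:R^-1].
Proof.
move=> Cpsi th0 psiK far eps0.
have lpsi := approximated_functional Cpsi.
have e0 : 0 < eps / 2 by lra.
have step_ex (s : seq (dual E * E)) : exists fx : dual E * E,
    [/\ forall y, `|fx.1 y| <= `|y|, th - eps / 2 <= psi fx.1,
        forall y, y \in unzip2 s -> `|fx.1 y| <= (size s).+1%:R^-1,
        C fx.2 &
        forall g, g \in [:: h, fx.1 & unzip1 s] -> `|g fx.2 - psi g| < eps / 2].
  have d0 : 0 < Num.min (eps / 2) (size s).+1%:R^-1 by rewrite lt_min e0/=.
  have [f [f1 psif fs]] := functional_near_kernel lpsi th0 psiK far (unzip2 s) d0.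
  have [x Cx xs] := Cpsi [:: h, f & unzip1 s] _ e0.
  exists (f, x); split=> //=.
    apply: le_trans (ltW psif); rewrite lerD2l lerN2.
    by rewrite ge_min lexx.
  by move=> y /fs /ltW /le_trans; apply; rewrite ge_min lexx orbT.
have [pick pickP] := choice step_ex.
pose hist := fix hist n := if n is k.+1 then pick (hist k) :: hist k else [::].
have hist_size n : size (hist n) = n by elim: n => //= n ->.
have hist_mem j n : (j < n)%N -> pick (hist j) \in hist n.
  elim: n => // n IH; rewrite ltnS leq_eqVlt inE => /orP[/eqP->|/IH->].
    by rewrite eqxx.
  by rewrite orbT.
exists (fun n => (pick (hist n)).1), (fun n => (pick (hist n)).2); split.
- by move=> n y; case: (pickP (hist n)) => + _ _ _ _; exact.
- move=> n; case: (pickP (hist n)) => _ _ _ Cx /(_ h).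
  rewrite inE eqxx => /(_ isT); rewrite ltr_norml => /andP[_ ?]; split=> //.
  lra.
- move=> k j kj.
  have psik : th - eps / 2 <= psi (pick (hist k)).1.
    by case: (pickP (hist k)).
  have km : (pick (hist k)).1 \in [:: h, (pick (hist j)).1 & unzip1 (hist j)].
    move: kj; rewrite leq_eqVlt => /orP[/eqP->|kj].
      by rewrite !inE eqxx orbT.
    rewrite 2!in_cons (_ : _ \in unzip1 _) ?orbT//.
    exact/map_f/hist_mem.
  case: (pickP (hist j)) => _ _ _ _ /(_ _ km).
  by rewrite ltr_norml => /andP[? _]; lra.
- move=> k j jk; case: (pickP (hist k)) => _ _ + _ _.
  by rewrite hist_size; apply; exact/map_f/hist_mem.
Qed.

End WeakApproximation.

(** Otherwise evaluations at some [x n] would approximate [psi] uniformly on the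
dual ball; the [x n] form a Cauchy sequence because the dual ball is norming, and
[psi] is the evaluation at its limit. *)
Lemma functional_far {R : realType} {E : completeNormedModType R}
    (psi : dual E -> R) : functional psi ->
  ~ (exists x, forall f : dual E, psi f = f x) ->
  exists2 th, 0 < th & forall x, exists2 f : dual E,
    (forall y, `|f y| <= `|y|) & th < psi f - f x.
Proof.
move=> lpsi; apply: contra_notP => nfar.
have near_ n : exists x, forall f : dual E, (forall y, `|f y| <= `|y|) ->
    psi f - f x <= n.+1%:R^-1.
  apply: contrapT => h; apply: nfar; exists n.+1%:R^-1 => // x.
  apply: contrapT => hx; apply: h; exists x => f f1.
  by rewrite leNgt; apply/negP => ?; apply: hx; exists f.
have [x xP] := choice near_.
have xP' n (f : dual E) : (forall y, `|f y| <= `|y|) ->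
    `|psi f - f (x n)| <= n.+1%:R^-1.
  move=> f1; rewrite ler_norml xP// andbT.
  have nf y : `|(- 1 *: f : dual E) y| <= `|y|.
    by rewrite dual_scaleE mulN1r normrN.
  have := xP n _ nf; rewrite functionalZ// dual_scaleE !mulN1r opprK addrC.
  by rewrite lerNl opprB.
have cx : cvg (x @ \oo).
  apply/cauchy_cvgP/cauchy_exP => e e0 /=.
  have e20 : 0 < e / 2 by lra.
  have [N _ NP] := near_infty_natSinv_lt (PosNum e20).
  exists (x N); exists N => // n Nn; rewrite -ball_normE/=.
  have [f [f1 fx]] := norming_functional (x N - x n).
  apply: le_lt_trans fx _; rewrite dualB.
  have triangle (a b p u v : R) : `|p - a| <= u -> `|p - b| <= v ->
      u < e / 2 -> v < e / 2 -> a - b < e.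
    by rewrite !ler_norml => /andP[? ?] /andP[? ?] ? ?; lra.
  exact: (triangle _ _ _ _ _ (xP' N f f1) (xP' n f f1) (NP N (leqnn N)) (NP n Nn)).
pose l := lim (x @ \oo); exists l.
have ball_eq (f : dual E) : (forall y, `|f y| <= `|y|) -> psi f = f l.
  move=> f1; have := dual_funP f; rewrite inE => -[_ cf].
  have fl : (f (x n)) @[n --> \oo] --> f l by exact: (cvg_comp _ _ cx (cf l)).
  apply/esym; apply: (cvg_unique (@Rhausdorff R) fl).
  apply/cvgrPdist_le => e e0; near=> n.
  apply: le_trans (xP' n f f1) _; apply/ltW.
  by near: n; exact: (near_infty_natSinv_lt (PosNum e0)).
move=> f; have [K K0 fK] := dual_bounded f.
have : psi (K^-1 *: f) = (K^-1 *: f) l.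
  apply: ball_eq => y; rewrite dual_scaleE normrM gtr0_norm ?invr_gt0//.
  by rewrite ler_pdivrMl.
rewrite functionalZ// dual_scaleE => /mulfI; apply.
by rewrite invr_eq0 gt_eqF.
Unshelve. all: by end_near. Qed.

(** * Convex blocks of a James sequence *)

Section ConvexBlocks.
Context {R : realType}.

Lemma convex_sum_ge (A : {fset nat}) (a F : nat -> R) (b : R) :
  (forall k, 0 <= a k) -> \sum_(k <- A) a k = 1 ->
  (forall k, k \in A -> b <= F k) -> b <= \sum_(k <- A) a k * F k.
Proof.
move=> a0 a1 Fb; rewrite -[leLHS]mul1r -a1 mulr_suml.
rewrite big_seq [leRHS]big_seq; apply: ler_sum => k kA.
by rewrite ler_wpM2l// Fb.
Qed.

Lemma convex_sum_norm_le (A : {fset nat}) (a F : nat -> R) (b : R) :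
  (forall k, 0 <= a k) -> \sum_(k <- A) a k = 1 ->
  (forall k, k \in A -> `|F k| <= b) -> `|\sum_(k <- A) a k * F k| <= b.
Proof.
move=> a0 a1 Fb; apply: le_trans (ler_norm_sum _ _ _) _.
rewrite -[leRHS]mul1r -a1 mulr_suml big_seq [leRHS]big_seq.
apply: ler_sum => k kA; rewrite normrM ger0_norm//.
by rewrite ler_wpM2l// Fb.
Qed.

Lemma disjoint_blocks_escape (A : nat -> {fset nat}) :
  (forall m n, m != n -> [disjoint A m & A n]%fset) ->
  forall K, \forall n \near \oo, forall k, k \in A n -> (K <= k)%N.
Proof.
move=> dA; elim=> [|K IH]; first by apply: nearW.
have [[n0 Kn0]|nK] := pselect (exists n, K \in A n).
  have n0n : \forall n \near \oo, (n0 < n)%N by exists n0.+1.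
  near=> n => k kA; rewrite ltn_neqAle; apply/andP; split; last first.
    by move: k kA; near: n.
  apply/eqP => Kk; rewrite -Kk in kA.
  have n0n' : n0 != n by rewrite ltn_eqF//; near: n.
  by have /fdisjointP/(_ _ Kn0)/negP := dA _ _ n0n'; apply.
near=> n => k kA; rewrite ltn_neqAle; apply/andP; split; last first.
  by move: k kA; near: n.
by apply/eqP => Kk; apply: nK; exists n; rewrite Kk.
Unshelve. all: by end_near. Qed.

(** Subtract from the convergent convex blocks their limit [l].  Blocks far
enough in the sequence only involve indices larger than [j], so [l (x j) = 0], and
the lower bound for [j] beyond a block is kept. *)
Lemma weak_star_null_blocks (E : normedModType R) (f : nat -> dual E)
    (x : nat -> E) (r : R) : convex_block_compact (dual_unit_ball E) ->
  (forall n y, `|f n y| <= `|y|) ->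
  (forall k j, (k <= j)%N -> r <= f k (x j)) ->
  (forall k j, (j < k)%N -> `|f k (x j)| <= k.+1%:R^-1) ->
  exists g : nat -> dual E, [/\ forall n y, `|g n y| <= 2 * `|y|,
    forall y, g n y @[n --> \oo] --> (0 : R) &
    forall n, exists J, forall j, (J <= j)%N -> r <= g n (x j)].
Proof.
move=> cbc f1 fge flt.
have [|y [[A [a [dA a0 yE a1]]] [l /dual_unit_ballP l1 yl]]] := cbc f.
  by move=> n; apply/dual_unit_ballP.
have ylim := weak_star_cvg yl.
have yEx n z : y n z = \sum_(k <- A n) a k * f k z :> R.
  by rewrite yE dual_sumE.
have lx0 j : l (x j) = 0 :> R.
  apply: (cvg_unique (@Rhausdorff R) (ylim (x j))).
  apply/cvgr0Pnorm_le => e e0.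
  have [N _ NP] := near_infty_natSinv_lt (PosNum e0).
  near=> n; rewrite yEx; apply: convex_sum_norm_le => // k kA.
  have kN : (maxn j.+1 N <= k)%N.
    by move: k kA; near: n; exact: disjoint_blocks_escape.
  move: kN; rewrite geq_max => /andP[jk Nk].
  by apply: le_trans (flt _ _ jk) _; apply: ltW; exact: NP.
exists (fun n => y n - l); split.
- move=> n z; rewrite dual_addE dual_oppE.
  apply: le_trans (ler_normB _ _) _; rewrite mulrDl mul1r lerD//.
  by rewrite yEx; apply: convex_sum_norm_le.
- move=> z; rewrite -(subrr (l z : R)).
  by apply: cvgB; [exact: ylim|exact: cvg_cst].
- move=> n; exists (\max_(k <- A n) k) => j Jj.
  rewrite dual_addE dual_oppE lx0 subr0 yEx; apply: convex_sum_ge => // k kA.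
  apply: fge; apply: leq_trans Jj; exact: leq_bigmax_seq.
Unshelve. all: by end_near. Qed.

End ConvexBlocks.

Lemma dual_dyadic {R : realType} {E : normedModType R} (g : nat -> dual E)
    (K : R) : (forall n x, `|g n x| <= K * `|x|) ->
  exists G : dual E, forall x, dyadic (fun p => g p x) @ \oo --> (G x : R).
Proof.
move=> gK.
pose L (x : E) : R^o := lim (dyadic (fun p => g p x) @ \oo).
have Lcvg x : dyadic (fun p => g p x) @ \oo --> L x.
  by apply: (@dyadic_bounded_cvg _ _ (K * `|x|)) => p; exact: gK.
have [a x y|x|G GL] := @bounded_linear_dual R E L K; last 1 first.
- by exists G => x; rewrite GL; exact: Lcvg.
- apply: (cvg_unique (@Rhausdorff R) (Lcvg _)).
  have -> : dyadic (fun p => g p (a *: x + y)) =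
      fun n => a * dyadic (fun p => g p x) n + dyadic (fun p => g p y) n.
    apply/funext => n; rewrite -dyadicD; congr (dyadic _ n).
    by apply/funext => p; rewrite dual_lin.
  by apply: cvgD; [apply: cvgMr; exact: Lcvg|exact: Lcvg].
- rewrite ler_norml; apply/andP; split.
    apply: (dyadic_lim_ge (Lcvg x)) => p.
    by have := gK p x; rewrite ler_norml => /andP[].
  apply: (dyadic_lim_le (Lcvg x)) => p.
  by have := gK p x; rewrite ler_norml => /andP[].
Qed.

(** * The one-sided argument *)

Section OneSidedJames.
Context {R : realType} {E : normedModType R}.

(** Simons' inequality applied to the functions [g - M h], with [g] in the
infinite convex hull of the [F n].  As [|g| <= 2 rho] on [C], the functional
[M h - g] is at least [1] there, so its minimum is attained. *)
Lemma null_sequence_not_separated (C : set E) (rho th M : R)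
    (h : dual E) (F : nat -> dual E) (x : nat -> E) :
  (forall c, C c -> `|c| <= rho) -> (forall n, C (x n)) -> 0 < th ->
  0 <= M -> 2 * rho + 1 <= M ->
  (forall c, C c -> 1 <= h c) ->
  (forall n, M * h (x n) <= M + th) ->
  (forall n y, `|F n y| <= 2 * `|y|) ->
  (forall y, F n y @[n --> \oo] --> (0 : R)) ->
  (forall n, exists J, forall j, (J <= j)%N -> 3 * th <= F n (x j)) ->
  ~ (forall f : dual E, (forall c, C c -> 1 <= f c) ->
      exists2 c, C c & forall c', C c' -> f c <= f c').
Proof.
move=> Crho Cx th0 M0 rhoM h1 hx F2 Fnull Fsep attain.
have [Kh Kh0 hK] := dual_bounded h.
(* Instead of the infinite convex hull of the F k with k >= n, it is enough to
   keep two of its properties, both stable under dyadic combinations. *)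
pose D' n (g : dual E) :=
  (forall y a, (forall k, (n <= k)%N -> F k y <= a) -> g y <= a) /\
  (forall e, 0 < e -> exists J, forall j, (J <= j)%N -> 3 * th - e <= g (x j)).
have D'2 n g y : D' n g -> `|g y| <= 2 * `|y|.
  move=> [gF _]; rewrite ler_norml lerNl; apply/andP; split.
    rewrite -dualN; apply: gF => k _.
    by have := F2 k (- y); rewrite normrN ler_norml => /andP[].
  by apply: gF => k _; have := F2 k y; rewrite ler_norml => /andP[].
pose D n (u : E -> R) := exists2 g, D' n g & forall y, u y = g y - M * h y.
have D'F n : D' n (F n).
  split=> [y a|e e0]; first by apply.
  have [J JP] := Fsep n; exists J => j Jj.
  by apply: le_trans (JP j Jj); lra.
have rho0 c : C c -> 0 <= rho by move=> Cc; exact: le_trans (Crho c Cc).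
have [c Cc cP] : exists2 c, C c &
    forall n, exists2 u, D n u & - M + th - th / 4 <= u c.
  apply: (@simons_inequality R E C D (2 * rho + M * (Kh * rho))).
  - by lra.
  - by move=> n; exists (fun y => F n y - M * h y); exists (F n).
  - move=> n u [g [gF gx] ug]; exists g => //; split=> // y a Fa.
    by apply: gF => k nk; apply: Fa; exact: ltnW.
  - move=> u y [g Dg ug] Cy; rewrite ug; apply: le_trans (ler_normB _ _) _.
    apply: lerD.
      by apply: le_trans (D'2 _ _ y Dg) _; rewrite ler_pM2l// Crho.
    rewrite normrM ger0_norm//; apply: ler_wpM2l => //.
    by apply: le_trans (hK y) _; rewrite ler_pM2l// Crho.
  - move=> n u Du; have [g gP] := choice (fun p =>
      let: ex_intro2 g a b := Du p in ex_intro (fun g => D' n g /\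
        forall y, u p y = g y - M * h y) g (conj a b)).
    have g2 p y : `|g p y| <= 2 * `|y| by apply: D'2; exact: (gP p).1.
    have [G GP] := dual_dyadic g2.
    exists (fun y => G y - M * h y); last first.
      move=> y _; rewrite (_ : dyadic _ = (fun n =>
          dyadic (fun p => g p y) n - M * dyadic (fun=> h y : R) n)).
        by apply: cvgB; [exact: GP|apply: cvgMr; exact: dyadic_cst].
      apply/funext => k; rewrite addrC -mulNr -dyadicD; congr (dyadic _ k).
      by apply/funext => p; rewrite (gP p).2 mulNr addrC.
    exists G => //; split.
      move=> y a Fa; apply: (dyadic_lim_le (GP y)) => p.
      exact: (gP p).1.1.
    move=> e e0.
    have e20 : 0 < e / 2 by lra.
    pose t := 3 * th - e / 2.
    pose S := `|t| + 2 * rho + 1.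
    have S0 : 0 < S.
      by rewrite /S; have := normr_ge0 t; have := rho0 _ (Cx 0%N); lra.
    (* The lower bounds along x hold from a rank depending on p; this is
       harmless since the terms beyond N have total weight 2^-N. *)
    have [N zS] : exists N, 2^-1 ^+ N * S <= e / 2.
      have /cvgr0Pnorm_le/(_ (e / 2 / S)) := @cvg_half R.
      rewrite divr_gt0// => /(_ isT) [N _ /(_ N (leqnn N))] /=.
      rewrite ger0_norm ?exprn_ge0// => zN; exists N.
      by rewrite -ler_pdivlMr.
    have [J JP] : exists J, forall p, (p < N)%N -> forall j, (J <= j)%N ->
        t <= g p (x j).
      elim: N {zS} => [|N [J JP]]; first by exists 0%N.
      have [J' J'P] := (gP N).1.2 _ e20.
      exists (maxn J J') => p; rewrite ltnS leq_eqVlt => /orP[/eqP->|pN] j.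
        by rewrite geq_max => /andP[_ ?]; exact: J'P.
      by rewrite geq_max => /andP[? _]; exact: JP.
    exists J => j Jj.
    have [G' G'P] := dual_dyadic (fun p => g2 (p + N)%N).
    have -> : G (x j) =
        dyadic (fun p => g p (x j)) N + 2^-1 ^+ N * (G' (x j) : R) :> R.
      have := GP (x j); rewrite -(cvg_shiftn N) => lim1.
      apply: (cvg_unique (@Rhausdorff R) lim1).
      rewrite [X in X @ _](_ : _ = fun k => dyadic (fun p => g p (x j)) N +
          2^-1 ^+ N * dyadic (fun p => g (p + N)%N (x j)) k); last first.
        by apply/funext => k; exact: dyadic_shift.
      by apply: cvgD; [exact: cvg_cst|apply: cvgMr; exact: G'P].
    have h2 := dyadic_ge (fun p pN => JP p pN j Jj).
    have h3 : - (2 * rho) <= G' (x j).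
      apply: (dyadic_lim_ge (G'P (x j))) => p.
      have := g2 (p + N)%N (x j); rewrite ler_norml => /andP[+ _].
      by apply: le_trans; rewrite lerN2 ler_pM2l// Crho.
    have z0 : 0 < 2^-1 ^+ N :> R by rewrite exprn_gt0.
    have := ler_norm t.
    rewrite -/t in h2.
    set z := 2^-1 ^+ N in zS h2 z0 *.
    move=> tt; have : z * - (2 * rho) <= z * (G' (x j) : R) by rewrite ler_pM2l.
    have : z * t <= z * `|t| by rewrite ler_pM2l.
    by rewrite /S in zS; rewrite /t in h2 *; lra.
  - move=> u [g Dg ug].
    have [f1|c Cc cmin] := attain (M *: h - g).
      move=> f1C; rewrite dual_addE dual_oppE dual_scaleE.
      have := D'2 _ _ f1 Dg; rewrite ler_norml => /andP[_ gf].
      by have := h1 _ f1C; have := Crho _ f1C; nra.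
    have umax y : C y -> u y <= u c.
      move=> /cmin; rewrite !dual_addE !dual_oppE !dual_scaleE !ug; lra.
    exists c => //; split=> //.
    have [J JP] := Dg.2 _ th0.
    apply: le_trans (umax _ (Cx J)); rewrite ug.
    by have := JP J (leqnn J); have := hx J; lra.
have /cvgr0Pnorm_le/(_ (th / 2)) := Fnull c.
rewrite divr_gt0// => /(_ isT)[N _ NP].
have [u [g [gF _] ug] uc] := cP N.
have := gF c (th / 2) (fun k Nk => le_trans (ler_norm _) (NP k Nk)).
by rewrite ug in uc; have := h1 c Cc; nra.
Qed.

End OneSidedJames.

(** A one-sided James theorem: if functionals bounded below by [1] on [C] attain
their minimum on [C], the weak-star closure of [C] lies in [E].  The functional
[h0] says that [C] is at positive distance from [0]. *)
Theorem one_sided_james_approximated {R : realType}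
    {E : completeNormedModType R} (C : set E) (phi : dual E -> R) (rho : R)
    (h0 : dual E) :
  convex_block_compact (dual_unit_ball E) ->
  convex_in C -> (forall c, C c -> `|c| <= rho) ->
  (forall c, C c -> 1 <= h0 c) ->
  (forall f : dual E, (forall c, C c -> 1 <= f c) ->
      exists2 c, C c & forall c', C c' -> f c <= f c') ->
  approximated C phi -> exists x, forall f : dual E, phi f = f x.
Proof.
move=> cbc cC Crho h01 attain Cphi; apply: contrapT => nphi.
have [m [m0 Cpsi vis]] := approximated_visible cC Crho Cphi h01.
set psi := fun f => phi f / m in Cpsi.
have lpsi := approximated_functional Cpsi.
have [th th0 far] : exists2 th, 0 < th & forall x, exists2 f : dual E,
    (forall y, `|f y| <= `|y|) & th < psi f - f x.
  apply: functional_far => // -[x xP]; apply: nphi; exists (m *: x) => f.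
  by rewrite dualZ -xP /psi mulrC divfK ?gt_eqF.
have psi_rho (f : dual E) : (forall y, `|f y| <= `|y|) -> `|psi f| <= rho.
  move=> f1; apply: (approximated_norm Cpsi) => c Cc.
  exact: le_trans (f1 c) (Crho c Cc).
have [c0 Cc0 _] := Cphi [::] 1 ltr01.
have rho0 : 0 <= rho by exact: le_trans (Crho _ Cc0).
pose M := 2 * rho + 1.
(* d serves both as visibility defect and as error of the James sequence; the
   margin needed below is M (d + d) <= th / 4. *)
pose d := th / (8 * (M + 1)).
have M0 : 0 < M by rewrite /M; lra.
have d0 : 0 < d by rewrite divr_gt0//; lra.
have dM : (M + 1) * d = th / 8 by rewrite /d; field; rewrite gt_eqF//; lra.
have [h h1 psih] := vis d d0.
have [f [x [f1 Cx fge flt]]] := james_sequence h Cpsi th0 psi_rho far d0.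
have [F [F2 Fnull Fsep]] := weak_star_null_blocks cbc f1 fge flt.
apply: (@null_sequence_not_separated R E C rho (th / 4) M h F x) => //.
- by move=> n; exact: (Cx n).1.
- by lra.
- exact: ltW.
- by move=> n; have := (Cx n).2; rewrite /psi => hx; nra.
- move=> n; have [J JP] := Fsep n; exists J => j /JP.
  by apply: le_trans; nra.
Qed.

(** * Weak compactness *)

Section WeakCompactness.
Context {R : realType} {E : normedModType R}.
Implicit Types (A : set E) (f g : dual E).

Lemma bounded_set_norm A : bounded_set A -> exists rho : R,
  forall a, A a -> `|a| <= rho.
Proof.
by move=> /pinfty_ex_gt0[rho _ Arho]; exists rho => a Aa; exact: Arho.
Qed.

Lemma closed_convex_weakly_closed A (phi : dual E -> R) x :
  convex_in A -> closed A -> approximated A phi ->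
  (forall f, phi f = f x) -> A x.
Proof.
move=> cA clA Aphi phix; apply: contrapT => nAx.
have : nbhs x (~` A) by apply: open_nbhs_nbhs; split=> //; exact: closed_openC.
move=> /nbhs_ballP[r /= r0 rA].
have [a0 Aa0 _] := Aphi [::] 1 ltr01.
pose B := [set a - x | a in A].
have [||_ [a Aa <-]|f [f1 fr]] := @dual_separation R E B r.
- by exists (a0 - x), a0.
- move=> _ _ t [a Aa <-] [b Ab <-] t0 t1.
  exists (t *: a + (1 - t) *: b); first exact: cA.
  rewrite !scalerBr addrACA -opprD -scalerDl.
  by rewrite [t + _]addrC subrK scale1r.
- rewrite leNgt; apply/negP => ar; apply: (rA a) => //.
  by rewrite -ball_normE/= distrC.
suff : f x + r <= f x by lra.
rewrite -[leRHS]phix; apply: (approximated_ge Aphi) => a Aa.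
by have := fr (a - x); rewrite dualB => /(_ (ex_intro2 _ _ a Aa erefl)); lra.
Qed.

Lemma ultra_bounded_cvg (T : Type) (F : set_system T) (u : T -> R) (K : R) :
  UltraFilter F -> F [set t | `|u t| <= K] -> exists l : R, u @ F --> l.
Proof.
move=> uF FK.
have [l [_ lF]] : exists l, (`[- K, K] `&` cluster (u @ F)) l.
  apply: (@segment_compact R (- K) K (u @ F)).
  suff : F (u @^-1` `[- K, K]) by [].
  by apply: filterS FK => t /=; rewrite in_itv/= ler_norml.
exists l => U lU; have [//|FU] := in_ultra_setVsetC (u @^-1` U) uF.
have [y [nUy Uy]] := lF (~` U) U FU lU.
by [].
Qed.

(** The limits of all functionals along an ultrafilter on [A] form a function
approximated by [A], hence an evaluation, whose point is the weak limit. *)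
Lemma weakly_compact_approximated A : bounded_set A -> closed A ->
  convex_in A ->
  (forall phi, approximated A phi -> exists x, forall f, phi f = f x) ->
  weakly_compact A.
Proof.
move=> /bounded_set_norm[rho Arho] clA cA repr.
rewrite /weakly_compact compact_ultra => F uF FA.
have lim_ex f : exists l : R, (fun x : E => f x : R) @ F --> l.
  have [K K0 fK] := dual_bounded f.
  apply: (@ultra_bounded_cvg _ _ _ (K * rho)); apply: filterS FA => a Aa /=.
  by apply: le_trans (fK a) _; rewrite ler_pM2l// Arho.
have [phi phiP] := choice lim_ex.
have Aphi : approximated A phi.
  move=> s e e0.
  have Fs : F [set x : E | forall g, g \in s -> `|g x - phi g| < e].
    elim: s => [|g s IH]; first by apply: filterS filterT.
    have Fg : F [set x : E | `|g x - phi g| < e].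
      have /cvgrPdist_lt/(_ e e0) := phiP g.
      by apply: filterS => x /=; rewrite distrC.
    apply: filterS2 Fg IH => x /= gx sx f.
    by rewrite inE => /orP[/eqP->|/sx].
  by have [x [Ax xs]] := filter_ex (filterI FA Fs); exists x.
have [x phix] := repr phi Aphi.
exists x; split; first exact: closed_convex_weakly_closed phix.
pose ev (y : E) : {ptws dual E -> R^o} := fun f : dual E => f y.
have evF : {ptws, ev @ F --> ev x}.
  apply/pointwise_cvgP => f; rewrite /= /ev -phix; exact: phiP.
move=> U; rewrite nbhsE => -[V [[W oW WV] Vx] VU].
apply: filterS VU _; rewrite -WV; apply: evF.
by apply: open_nbhs_nbhs; split=> //; rewrite -WV in Vx.
Qed.

End WeakCompactness.

(** * Two convex sets at positive distance *)

Lemma sup_lt_inf {R : realType} {E : normedModType R} (A B : set E)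
    (f : dual E) (s t : R) :
  (forall b, B b -> f b <= s) -> s < t -> (forall a, A a -> t <= f a) ->
  (sup_on B f < inf_on A f)%E.
Proof.
move=> Bs st At; apply: (@le_lt_trans _ _ s%:E).
  by apply: ge_ereal_sup => _ [b Bb <-]; rewrite lee_fin Bs.
apply: (@lt_le_trans _ _ t%:E); first by rewrite lte_fin.
by apply: le_ereal_inf_tmp => _ [a Aa <-]; rewrite lee_fin At.
Qed.

Lemma set_dist_gt0 {R : realType} {E : normedModType R} (A B : set E) :
  (0 < set_dist A B)%E ->
  exists2 r : R, 0 < r & forall a b, A a -> B b -> r <= `|a - b|.
Proof.
move=> d0.
have [r r0 rd] : exists2 r : R, 0 < r & (r%:E <= set_dist A B)%E.
  case: (set_dist A B) d0 => [r r0|_|//]; first by exists r.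
  by exists 1 => //; exact: leey.
exists r => // a b Aa Bb; rewrite -lee_fin; apply: le_trans rd _.
by apply: ereal_inf_lbound; exists a => //; exists b.
Qed.

Theorem theorem2 (R : realType) (E : completeNormedModType R)
    (E_cbc : convex_block_compact (dual_unit_ball E))
    (A B : set E)
    (A_bounded : bounded_set A) (A_closed : closed A) (A_convex : convex_set A)
    (B_bounded : bounded_set B) (B_closed : closed B) (B_convex : convex_set B)
    (AB_dist : (0 < set_dist A B)%E)
    (AB_attain : forall f : dual E, (sup_on B f < inf_on A f)%E ->
       attains_inf A f /\ attains_sup B f) :
  weakly_compact A /\ weakly_compact B.
Proof.
have cA := convex_set_in A_convex; have cB := convex_set_in B_convex.
have [rA ArA] := bounded_set_norm A_bounded.
have [rB BrB] := bounded_set_norm B_bounded.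
have B0f b : (0 : dual E) b = 0 :> R by [].
(* If A or B is empty, the zero functional satisfies the strict inequality but
   attains nothing on the empty set. *)
have [a0 Aa0] : A !=set0.
  apply: contrapT => A0.
  have [|[a Aa _] _] := AB_attain 0; last by apply: A0; exists a.
  apply: (@sup_lt_inf _ _ _ _ _ 0 1) => [b _|//|]; first by rewrite B0f.
  by move=> a Aa; exfalso; apply: A0; exists a.
have [b0 Bb0] : B !=set0.
  apply: contrapT => B0.
  have [|_ [b Bb _]] := AB_attain 0; last by apply: B0; exists b.
  apply: (@sup_lt_inf _ _ _ _ _ (-1) 0) => [|//|]; last by move=> a _; rewrite B0f.
  by move=> b Bb; exfalso; apply: B0; exists b.
pose C := [set c | exists a b, [/\ A a, B b & c = a - b]].
have cC : convex_in C.
  move=> _ _ t [a [b [Aa Bb ->]]] [a' [b' [Aa' Bb' ->]]] t0 t1.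
  exists (t *: a + (1 - t) *: a'), (t *: b + (1 - t) *: b').
  split; [exact: cA|exact: cB|].
  by rewrite !scalerBr opprD addrACA.
have Crho c : C c -> `|c| <= rA + rB.
  move=> [a [b [Aa Bb ->]]]; apply: le_trans (ler_normB _ _) _.
  by rewrite lerD ?ArA ?BrB.
have [r r0 rAB] := set_dist_gt0 AB_dist.
have [||_ [a [b [Aa Bb ->]]]|f0 [_ f0r]] := @dual_separation R E C r.
- by exists (a0 - b0), a0, b0.
- exact: cC.
- exact: rAB.
have h1 c : C c -> 1 <= (r^-1 *: f0) c.
  by move=> Cc; rewrite dual_scaleE ler_pdivlMl// mulr1; exact: f0r.
have attain (f : dual E) : (forall c, C c -> 1 <= f c) ->
    exists2 c, C c & forall c', C c' -> f c <= f c'.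
  move=> fC.
  have fAB a b : A a -> B b -> (f b : R) + 1 <= f a.
    move=> Aa Bb; have := fC (a - b); rewrite dualB.
    by move=> /(_ (ex_intro _ a (ex_intro _ b (And3 Aa Bb erefl)))); lra.
  pose S := [set (f b : R) | b in B].
  have Ssup : has_sup S.
    split; first by exists (f b0), b0.
    by exists (f a0) => _ [b Bb <-]; have := fAB _ _ Aa0 Bb; lra.
  have [|[a Aa fa] [b Bb fb]] := AB_attain f.
    apply: (@sup_lt_inf _ _ _ _ _ (sup S) (sup S + 1)).
    - by move=> b Bb; apply: ub_le_sup Ssup.2 _ _; exists b.
    - by rewrite ltrDl.
    - move=> a Aa; rewrite -lerBrDr; apply: ge_sup Ssup.1 _ => _ [b Bb <-].
      by have := fAB _ _ Aa Bb; lra.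
  exists (a - b); first by exists a, b.
  move=> _ [a' [b' [Aa' Bb' ->]]]; rewrite !dualB; apply: lerB.
    by rewrite -lee_fin fa; apply: ereal_inf_lbound; exists a'.
  by rewrite -lee_fin fb; apply: ereal_sup_ubound; exists b'.
have reprC phi := @one_sided_james_approximated _ _ C phi (rA + rB) _ E_cbc cC
  Crho h1 attain.
split; apply: weakly_compact_approximated => // phi Xphi.
- have [|x phix] := reprC (fun f => phi f - f b0).
    move=> s e e0; have [a Aa as_] := Xphi s e e0.
    exists (a - b0); first by exists a, b0.
    by move=> g /as_; rewrite dualB opprB addrA subrK.
  exists (x + b0) => f; rewrite dualD -phix; lra.
- have [|x phix] := reprC (fun f => (f a0 : R) - phi f).
    move=> s e e0; have [b Bb bs] := Xphi s e e0.
    exists (a0 - b); first by exists a0, b.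
    move=> g /bs; rewrite -normrN (_ : - _ = g (a0 - b) - (g a0 - phi g))//.
    by rewrite dualB; ring.
  exists (a0 - x) => f; rewrite dualB -phix; lra.
Qed.
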